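(* Let $\alpha,\beta\in(0,1)$, $\epsilon,\delta>0$, $\Delta_\infty>0$. Suppose the linear program $Ax\le b$ ($A\in\mathbb{R}^{m\times d}$, $b\in\mathbb{R}^m$) has a probability distribution on $[d]$ as a feasible solution. The primal multiplicative weights LP algorithm, run with the $\epsilon'$-private exponential mechanism as dual oracle, is $(\epsilon,\delta)$-low sensitivity scalar private with sensitivity $\Delta_\infty$, and with probability at least $1-\beta$ finds $x^*$ satisfying $Ax^*\le b+\alpha\cdot\mathbf 1$, where \[\alpha=\tilde O\left(\frac{\rho^{1/2}\Delta_\infty^{1/2}}{\epsilon^{1/2}}\log^{1/4}d\,\log^{1/4}(1/\delta)\,\log^{1/2}(1/\beta)\,\log^{1/2}m\right).\]
   Context: $\rho=\max_{ij}|A_{ij}|$. A randomized algorithm $\mathcal{M}(b,A)$ is $(\epsilon,\delta)$-low sensitivity scalar private with sensitivity $\Delta_\infty$ if for all $b,b'$ with $\|b-b'\|_\infty\le\Delta_\infty$ and all $S\subseteq\mathbb{R}^d$, $\Pr[\mathcal{M}(b,A)\in S]\le e^\epsilon\Pr[\mathcal{M}(b',A)\in S]+\delta$. Primal multiplicative weights LP algorithm (accuracy parameter $\alpha$): $T=9\rho^2\log d/\alpha^2$, $\eta=\sqrt{\log d/T}$, $\tilde x^1$ uniform on $[d]$; for $t=1,\dots,T$: $p^t=\mathrm{Oracle}(A,b,\tilde x^t)$, losses $\ell^t_i=A_{p^ti}/\rho$, $x^{t+1}_i=e^{-\eta\ell^t_i}\tilde x^t_i$, $\tilde x^{t+1}=x^{t+1}/\sum_ix^{t+1}_i$;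 output $\bar x=\frac1T\sum_t\tilde x^t$. Oracle: with $\epsilon'=\epsilon/\sqrt{8T\log(1/\delta)}$, the $\epsilon'$-private exponential mechanism outputs $i\in[m]$ with probability proportional to $\exp\big(\epsilon'(A_i\tilde x^t-b_i)/(2\Delta_\infty)\big)$.
   Formalization: Requires δ<1 (else ε' is undefined); privacy is claimed only for ε ≤ 8 log(1/δ), as it fails for ε much larger than log(1/δ); the constant in Õ is uniform over β ≤ β₀ for each fixed β₀<1, since no constant works as β→1. *)

(* Defs.v *)
(* MathComp / MathComp-Analysis *)
From mathcomp Require Import all_boot all_order all_algebra.
From mathcomp Require Import all_classical all_reals all_analysis.

Set Implicit Arguments.
Unset Strict Implicit.
Unset Printing Implicit Defensive.

Import Order.TTheory GRing.Theory Num.Theory.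
Import numFieldNormedType.Exports.

Local Open Scope classical_set_scope.
Local Open Scope ring_scope.

(* The mechanism below draws finitely many indices from finite sets, so its
   output law is finitely supported; such a law is given by the probability it
   assigns to every subset of the outcome space, measurability being void. *)
Definition law (R : realType) (X : Type) := set X -> R.

(* [`|b - b'|] is MathComp-Analysis's matrix norm, i.e. the largest absolute
   value of an entry. *)
Definition low_sensitivity_scalar_private (R : realType) (m d : nat)
    (eps delta Delta : R)
    (M : 'cV[R]_m -> 'M[R]_(m, d) -> law R 'cV[R]_d) : Prop :=
  forall (A : 'M[R]_(m, d)) (b b' : 'cV[R]_m) (S : set 'cV[R]_d),
    `|b - b'| <= Delta -> M b A S <= expR eps * M b' A S + delta.

Definition is_distribution (R : realType) (d : nat) (x : 'cV[R]_d) : Prop :=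
  (forall j, 0 <= x j 0) /\ \sum_j x j 0 = 1.

Section Algorithm.
Context {R : realType} {m d : nat}.
Implicit Types (A : 'M[R]_(m, d)) (b : 'cV[R]_m) (x s : 'cV[R]_d).

Definition width A : R := `|A|.

(* The number of rounds has to be a positive integer: round
   [9 rho^2 log d / alpha^2] up, and run one round when it is 0. *)
Definition rounds A (alpha : R) : nat :=
  maxn 1 (absz (Num.ceil (9 * width A ^+ 2 * ln d%:R / alpha ^+ 2))).

Definition learning_rate A (alpha : R) : R :=
  Num.sqrt (ln d%:R / (rounds A alpha)%:R).

Definition mw_update A (eta : R) x (p : 'I_m) : 'cV[R]_d :=
  let y := \col_j (expR (- eta * (A p j / width A)) * x j 0) in
  (\sum_j y j 0)^-1 *: y.

Definition uniform_vec : 'cV[R]_d := const_mx d%:R^-1.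

(* The exponential mechanism with quality score [A_i x - b_i]: the probability
   of answering [i]. *)
Definition exp_mechanism A b (eps' Delta : R) x (i : 'I_m) : R :=
  let weight k := expR (eps' * ((A *m x) k 0 - b k 0) / (2 * Delta)) in
  weight i / \sum_k weight k.

(* [mw_loop A eta T oracle n x s] is the law of [(s + z_1 + ... + z_n) / T],
   where [z_1 = x] and [z_(t+1)] is the update of [z_t] with an index drawn
   from [oracle z_t]; it is computed by conditioning on the first draw. *)
Fixpoint mw_loop A (eta : R) (T : nat) (oracle : 'cV[R]_d -> 'I_m -> R)
    (n : nat) x s : law R 'cV[R]_d := fun S =>
  if n is n'.+1 then
    \sum_(p < m) oracle x p * mw_loop A eta T oracle n' (mw_update A eta x p) (s + x) S
  else \1_S (T%:R^-1 *: s).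

Definition oracle_privacy A (alpha eps delta : R) : R :=
  eps / Num.sqrt (8 * (rounds A alpha)%:R * ln (1 / delta)).

Definition primal_mw (alpha eps delta Delta : R) b A : law R 'cV[R]_d :=
  let T := rounds A alpha in
  mw_loop A (learning_rate A alpha) T
    (exp_mechanism A b (oracle_privacy A alpha eps delta) Delta)
    T uniform_vec 0.

Definition accuracy_rate A (beta eps delta Delta : R) : R :=
  width A `^ (1 / 2) * Delta `^ (1 / 2) / eps `^ (1 / 2)
  * ln d%:R `^ (1 / 4) * ln (1 / delta) `^ (1 / 4)
  * ln (1 / beta) `^ (1 / 2) * ln m%:R `^ (1 / 2).

End Algorithm.

(* [soft_bound C k g] is the generic member [C g (1 + |log g|)^k] of the class
   [O~(g)]; the absolute value is there because [g] may be less than 1. *)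
Definition soft_bound (R : realType) (C : R) (k : nat) (g : R) : R :=
  C * g * (1 + `|ln g|) ^+ k.

Lemma exp_mechanism_sum1 (R : realType) (m d : nat) (A : 'M[R]_(m, d))
    (b : 'cV[R]_m) (eps' Delta : R) (x : 'cV[R]_d) :
  (0 < m)%N -> \sum_i exp_mechanism A b eps' Delta x i = 1.
Proof.
move=> m0; rewrite /exp_mechanism -mulr_suml divff // gt_eqF //.
rewrite (bigD1 (Ordinal m0)) //= ltr_pwDl ?expR_gt0 //.
by apply: sumr_ge0 => i _; exact: expR_ge0.
Qed.

Lemma primal_mw_setT (R : realType) (m d : nat) (alpha eps delta Delta : R)
    (b : 'cV[R]_m) (A : 'M[R]_(m, d)) :
  (0 < m)%N -> primal_mw alpha eps delta Delta b A setT = 1.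
Proof.
move=> m0; rewrite /primal_mw.
have loop1 eta T n x s : mw_loop A eta T
    (exp_mechanism A b (oracle_privacy A alpha eps delta) Delta) n x s setT = 1.
  elim: n x s => [|n IH] x s /=; first by rewrite indicT.
  rewrite -[RHS](exp_mechanism_sum1 A b (oracle_privacy A alpha eps delta) Delta x m0).
  by apply: eq_bigr => p _; rewrite IH mulr1.
exact: loop1.
Qed.

(* Main.v *)
(* Privacy.  Changing [b] by [Delta] moves the log-weights of the exponential
   mechanism by at most [eps' / 2], so the privacy loss [Y] of a round has range
   of length [eps'], and its mean under the second law, the negative of a
   relative entropy, is nonpositive; Hoeffding's lemma bounds its exponential moments
   by [exp ((lam + 1)^2 eps'^2 / 8)].  A Chernoff bound, carried through the
   rounds by conditioning on the first draw, gives the tail [delta].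

   Utility.  The relative entropy to a feasible point decreases in each round by
   the excess of the chosen constraint, up to [eta^2 / 2] (Hoeffding again), which
   costs [alpha / 2] on average.  The gap between the most violated constraint and
   the drawn one satisfies [E exp (theta gap) <= m] with
   [theta = eps' / (2 Delta)].  Multiplying these moments over the rounds, rather
   than taking a union bound, shows that the average gap exceeds
   [(log m + log (1 / beta) / T) / theta] with probability at most [beta]; as no
   [log T] appears, the soft bound holds with exponent 0.  This uses
   [T = O (rho^2 log d / alpha^2)], which fails when that quantity is rounded up
   to [T = 1]; but then the output is the uniform vector, whose error is at most
   [2 rho <= alpha] (and 0 if [d = 1]). *)

Require Import Defs.
From mathcomp Require Import all_boot all_order all_algebra.
From mathcomp Require Import all_classical all_reals all_analysis.
From mathcomp Require Import ring lra.
Import Order.TTheory GRing.Theory Num.Theory.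
Import numFieldNormedType.Exports.
Local Open Scope classical_set_scope.
Local Open Scope ring_scope.

(** * Hoeffding's lemma for finitely supported laws *)

Lemma ge0_is_derive_ndecr (R : realType) (f g : R -> R) (x : R) :
  (forall y : R, is_derive y 1 f (g y)) -> (forall y, 0 < y -> 0 <= g y) ->
  0 <= x -> f 0 <= f x.
Proof.
move=> df g0 x0; apply: (@ger0_derive1_ndecry _ f 0) => //.
- by move=> y; rewrite in_itv /= andbT => /g0; rewrite derive1E derive_val.
- by apply: derivable_within_continuous => y _; exact: ex_derive.
Qed.

(** This is [tanh (x / 2) <= x / 2] cleared of denominators; the derivative of the difference is
    nonnegative because [expR (- y) >= 1 - y]. *)
Lemma expR_sub1_le (R : realType) (x : R) : 0 <= x ->
  expR x - 1 <= x / 2 * (expR x + 1).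
Proof.
pose f (y : R) := y / 2 * (expR y + 1) - expR y + 1 : R.
suff : 0 <= x -> f 0 <= f x by move=> /[apply]; rewrite /f expR0; lra.
apply: (@ge0_is_derive_ndecr _ _ (fun y => (expR y + 1) / 2 + y / 2 * expR y - expR y)).
  by move=> y; rewrite /f; apply: is_derive_eq; rewrite /GRing.scale /=; field.
move=> y _; have := expR_ge1Dx (- y).
rewrite expRN -(ler_pM2r (expR_gt0 y)) mulVf ?gt_eqF ?expR_gt0 //; lra.
Qed.

(** Hoeffding's lemma for a Bernoulli law: the quotient of the two sides decreases in [h]. With
    [E = expR (y / 2)], its derivative has the sign of [p (1 - p) (E^2 - 1) - y / 4 (1 - p + p
    E^2)], which the [tanh] bound at [y / 2] and a square make nonpositive. *)
Lemma expR_two_points (R : realType) (p h : R) : 0 <= p <= 1 -> 0 <= h ->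
  1 - p + p * expR h <= expR (p * h + h ^+ 2 / 8).
Proof.
move=> /andP[p0 p1].
pose f (y : R) := - ((1 - p + p * expR y) * expR (- (p * y + y ^+ 2 / 8))) : R.
suff : 0 <= h -> f 0 <= f h.
  have -> : f 0 = -1 by rewrite /f !mulr0 expr0n mul0r addr0 oppr0 expR0; ring.
  by move=> /[apply]; rewrite /f expRN lerN2 ler_pdivrMr ?expR_gt0// mul1r.
apply: (@ge0_is_derive_ndecr _ _ (fun y =>
   ((1 - p + p * expR y) * (p + y / 4) - p * expR y)
    * expR (- (p * y + y ^+ 2 / 8)))).
  by move=> y; rewrite /f; apply: is_derive_eq; rewrite /GRing.scale /=; field.
move=> y y0; rewrite mulr_ge0 ?expR_ge0//.
have := @expR_sub1_le _ (y / 2); have -> : expR y = expR (y / 2) ^+ 2.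
  by rewrite expr2 -expRD; congr expR; field.
have := expR_gt0 (y / 2); move: (expR _) => E E0 /(_ _)/wrap[|tanhE]; first lra.
(* The difference of the two sides is [(1 - p - p E)^2]. *)
have le1 : p * (1 - p) * (E + 1) ^+ 2 <= 1 - p + p * E ^+ 2.
  have := sqr_ge0 (1 - p - p * E); lra.
have le2 : p * (1 - p) * (E + 1) * (E - 1) <= p * (1 - p) * (E + 1) * (y / 2 / 2 * (E + 1)).
  by apply: ler_wpM2l => //; rewrite !mulr_ge0 //; lra.
have : y / 4 * (p * (1 - p) * (E + 1) ^+ 2) <= y / 4 * (1 - p + p * E ^+ 2).
  by rewrite ler_wpM2l//; lra.
lra.
Qed.

(** Convexity puts [expR] below its chord on [[a, a + w]], which reduces the claim to the two-point
    law on the endpoints with the same mean. *)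
Lemma hoeffding_expR (R : realType) (I : finType) (q y : I -> R) (a w : R) :
  (forall i, 0 <= q i) -> \sum_i q i = 1 -> (forall i, a <= y i <= a + w) ->
  \sum_i q i * expR (y i) <= expR (\sum_i q i * y i + w ^+ 2 / 8).
Proof.
move=> q0 q1 ya.
have sumE F : \sum_i q i * (a + w * F i) = a + w * \sum_i q i * F i.
  rewrite -[a in RHS]mul1r -q1 mulr_suml mulr_sumr -big_split/=.
  by apply: eq_bigr => i _; ring.
have [i0 _|I0] := pickP (@predT I); last first.
  by move: q1; rewrite big_pred0// => /eqP; rewrite eq_sym oner_eq0.
have [ya1 ya2] : (forall i, a <= y i) /\ (forall i, y i <= a + w).
  by split=> i; case/andP: (ya i).
have w0 : 0 <= w by have := ya1 i0; have := ya2 i0; lra.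
(* If [w = 0] this quotient is 0, which is harmless because every [y i] then equals [a]. *)
pose F i := (y i - a) / w.
have yE i : y i = a + w * F i.
  rewrite /F mulrC; have [w_eq0|wn0] := eqVneq w 0; last by rewrite divfK//; lra.
  by rewrite w_eq0 mulr0; have := ya1 i; have := ya2 i; rewrite w_eq0; lra.
have F01 i : 0 <= F i <= 1.
  rewrite /F; have [->|wn0] := eqVneq w 0; first by rewrite invr0 mulr0 lexx ler01.
  rewrite ler_pdivrMr ?lt0r ?wn0// divr_ge0 ?subr_ge0//=.
  by rewrite mul1r lerBlDl.
have -> : \sum_i q i * y i = a + w * \sum_i q i * F i.
  by rewrite -sumE; apply: eq_bigr => i _; rewrite -yE.
set p := \sum_i q i * F i.
have p01 : 0 <= p <= 1.
  rewrite sumr_ge0 => [/=|i _]; last by rewrite mulr_ge0//; case/andP: (F01 i).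
  by rewrite -q1 ler_sum// => i _; rewrite ler_piMr//; case/andP: (F01 i).
apply: (@le_trans _ _ (expR a * (1 - p + p * expR w))); last first.
  by rewrite -(addrA a) expRD ler_pM2l ?expR_gt0// (mulrC w) expR_two_points.
have -> : expR a * (1 - p + p * expR w) =
    \sum_i q i * (expR a * (1 - F i + F i * expR w)).
  rewrite -[1 in LHS]q1 /p mulr_suml -sumrB -big_split/= mulr_sumr.
  by apply: eq_bigr => i _; ring.
apply: ler_sum => i _; apply: ler_wpM2l => //.
rewrite yE expRD ler_pM2l ?expR_gt0//.
have := @convex_expR R (Itv01 (proj1 (andP (F01 i))) (proj2 (andP (F01 i)))) w 0.
by rewrite !convRE /= mulr0 addr0 expR0 mulr1 (mulrC w) addrC.
Qed.

(** * Privacy of the exponential mechanism and of the loop *)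

Definition gibbs (R : realType) (I : finType) (g : I -> R) (i : I) : R :=
  expR (g i) / \sum_k expR (g k).
Arguments gibbs {R I}.

Lemma sum_expR_gt0 (R : realType) (I : finType) (g : I -> R) (i : I) :
  0 < \sum_k expR (g k).
Proof.
rewrite (bigD1 i)//= ltr_pwDl ?expR_gt0//.
by apply: sumr_ge0 => k _; exact: expR_ge0.
Qed.

Lemma gibbs_ge0 (R : realType) (I : finType) (g : I -> R) i : 0 <= gibbs g i.
Proof. by rewrite divr_ge0 ?expR_ge0// ltW// (sum_expR_gt0 _ _ g i). Qed.

Lemma sum_gibbs (R : realType) (I : finType) (g : I -> R) (i : I) :
  \sum_k gibbs g k = 1.
Proof. by rewrite -mulr_suml divff// gt_eqF// (sum_expR_gt0 _ _ g i). Qed.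

(** [Y] is the log-likelihood ratio. Since [gibbs g] is [gibbs h] tilted by [expR Y], the moment
    becomes one of order [lam + 1] under [gibbs h], where Hoeffding's lemma applies with range
    [(lam + 1) * w]. *)
Lemma gibbs_loss_moment (R : realType) (I : finType) (i0 : I) (g h : I -> R) (w : R) :
  (forall i, `|g i - h i| <= w / 2) ->
  exists Y : I -> R, (forall i, gibbs g i = gibbs h i * expR (Y i)) /\
    forall lam, 0 <= lam ->
      \sum_i gibbs g i * expR (lam * Y i) <= expR ((lam + 1) ^+ 2 * w ^+ 2 / 8).
Proof.
move=> gh; pose c := ln (\sum_k expR (g k)) - ln (\sum_k expR (h k)).
exists (fun i => g i - h i - c).
have gE i : gibbs g i = gibbs h i * expR (g i - h i - c).
  have Zg0 := sum_expR_gt0 _ _ g i; have Zh0 := sum_expR_gt0 _ _ h i.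
  rewrite /gibbs /c !expRB !lnK ?posrE//.
  by field; rewrite !gt_eqF ?expR_gt0.
split=> // lam lam0.
(* Minus a relative entropy: [Y <= exp Y - 1], and [exp Y] has mean 1. *)
have loss_le0 : \sum_i gibbs h i * (g i - h i - c) <= 0.
  apply: (@le_trans _ _ (\sum_i (gibbs g i - gibbs h i))); last first.
    by rewrite sumrB !sum_gibbs// subrr.
  apply: ler_sum => i _; rewrite gE.
  by have := ler_wpM2l (gibbs_ge0 _ _ h i) (expR_ge1Dx (g i - h i - c)); lra.
under eq_bigr => i _.
  rewrite {}gE -mulrA -expRD -[X in X + _]mul1r -mulrDl [1 + _]addrC; over.
have yb i : (lam + 1) * (- (w / 2) - c) <= (lam + 1) * (g i - h i - c)
            <= (lam + 1) * (- (w / 2) - c) + (lam + 1) * w.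
  have := gh i; rewrite ler_norml => /andP[g1 g2].
  by rewrite -mulrDr !ler_pM2l; lra.
apply: (le_trans (hoeffding_expR _ _ _ _ _ _ (gibbs_ge0 _ _ h) (sum_gibbs _ _ h i0) yb)).
rewrite ler_expR exprMn -[leRHS]add0r lerD2r.
under eq_bigr do rewrite mulrCA.
by rewrite -mulr_sumr mulr_ge0_le0//; lra.
Qed.

(* For every threshold [c]: outside the event that the total privacy loss exceeds
   [c] the likelihood ratio is at most [exp c]; the last term is the Chernoff
   bound for that event. *)
Lemma mw_loop_loss_le (R : realType) (m d : nat) (A : 'M[R]_(m, d)) (eta : R)
    (T : nat) (P Q : 'cV[R]_d -> 'I_m -> R) (lam K : R) :
  0 <= lam -> 0 <= K -> (forall x i, 0 <= P x i) ->
  (forall x, exists Y : 'I_m -> R, (forall i, P x i = Q x i * expR (Y i)) /\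
    \sum_i P x i * expR (lam * Y i) <= K) ->
  forall n x s S c, mw_loop A eta T P n x s S <=
    expR c * mw_loop A eta T Q n x s S + expR (- (lam * c)) * K ^+ n.
Proof.
move=> lam0 K0 P0 PQ; elim=> [|n IH] x s S c /=.
  rewrite expr0 mulr1 indicE; case: (_ \in S); rewrite ?mulr0 ?add0r ?expR_ge0// mulr1.
  (* For [c >= 0] the first term suffices; for [c < 0] the tail term is already at least 1. *)
  have [c0|/ltW c0] := leP 0 c.
    by rewrite -[leLHS]addr0 lerD ?expR_ge0// -expR0 ler_expR.
  rewrite -[leLHS]add0r lerD ?expR_ge0// -expR0 ler_expR oppr_ge0.
  by rewrite mulr_ge0_le0.
have [Y [PE PK]] := PQ x.
(* Drawing [p] uses up [Y p] of the threshold, hence the induction hypothesis at [c - Y p]; the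
   factor [expR (- Y p)] then converts [P] into [Q]. *)
apply: (@le_trans _ _ (\sum_p P x p * (expR (c - Y p) *
    mw_loop A eta T Q n (mw_update A eta x p) (s + x) S
    + expR (- (lam * (c - Y p))) * K ^+ n))).
  by apply: ler_sum => p _; rewrite ler_wpM2l.
under [leLHS]eq_bigr do rewrite mulrDr.
rewrite big_split/= lerD//.
  rewrite mulr_sumr ler_sum// => p _; rewrite PE expRD expRN.
  rewrite le_eqVlt; apply/orP; left; apply/eqP.
  by field; rewrite gt_eqF ?expR_gt0.
rewrite exprS mulrA.
apply: (@le_trans _ _ (expR (- (lam * c)) * K ^+ n * \sum_i P x i * expR (lam * Y i))).
  rewrite mulr_sumr ler_sum// => p _.
  have -> : - (lam * (c - Y p)) = - (lam * c) + lam * Y p by ring.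
  by rewrite expRD le_eqVlt; apply/orP; left; apply/eqP; ring.
by rewrite [leRHS]mulrAC ler_wpM2l// mulr_ge0 ?exprn_ge0 ?expR_ge0.
Qed.

Lemma mx_entry_le_norm (R : realType) (m n : nat) (A : 'M[R]_(m, n)) i j :
  `|A i j| <= `|A|.
Proof.
rewrite [leRHS]mx_normrE.
by have /= := le_bigmax (0 : R) (fun ij : 'I_m * 'I_n => `|A ij.1 ij.2|) (i, j); apply.
Qed.

Lemma rounds_gt0 (R : realType) (m d : nat) (A : 'M[R]_(m, d)) (alpha : R) :
  0 < (rounds A alpha)%:R :> R.
Proof. by rewrite ltr0n /rounds leq_max. Qed.

(** The bound on [eps] serves the Chernoff argument: it keeps the multiplier [lam] nonnegative and
    the final exponent at most [ln delta]. *)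
Lemma primal_mw_private (R : realType) (m d : nat) (alpha eps delta Delta : R) :
  (0 < m)%N -> 0 < eps -> 0 < delta < 1 -> 0 < Delta ->
  eps <= 8 * ln (1 / delta) ->
  low_sensitivity_scalar_private eps delta Delta
    (@primal_mw R m d alpha eps delta Delta).
Proof.
move=> m0 eps0 /andP[delta0 delta1] Delta0; rewrite div1r lnV ?posrE// => epsL.
move=> A b b' S bb'; rewrite /primal_mw /oracle_privacy div1r lnV ?posrE//.
set L := - ln delta in epsL *.
have L0 : 0 < L by rewrite oppr_gt0 ln_lt0// delta0.
set T := rounds A alpha; have T0 : 0 < T%:R :> R := rounds_gt0 _ _ _ A alpha.
set w := eps / Num.sqrt _.
have w0 : 0 < w by rewrite divr_gt0// sqrtr_gt0 !mulr_gt0.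
have wE : w ^+ 2 = eps ^+ 2 / (8 * T%:R * L).
  by rewrite /w exprMn exprVn sqr_sqrtr// !mulr_ge0// ltW.
(* With [T w^2 = eps^2 / (8 L)], this choice makes the Chernoff exponent
   [eps - 16 L], which is at most [- L]. *)
pose lam := 32 * L / eps - 1.
have lam0 : 0 <= lam by rewrite /lam subr_ge0 ler_pdivlMr//; lra.
have step x : exists Y : 'I_m -> R,
    (forall i, exp_mechanism A b w Delta x i
               = exp_mechanism A b' w Delta x i * expR (Y i)) /\
    \sum_i exp_mechanism A b w Delta x i * expR (lam * Y i)
      <= expR ((lam + 1) ^+ 2 * w ^+ 2 / 8).
  have [|Y [YE YK]] := @gibbs_loss_moment R _ (Ordinal m0)
      (fun k => w * ((A *m x) k 0 - b k 0) / (2 * Delta))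
      (fun k => w * ((A *m x) k 0 - b' k 0) / (2 * Delta)) w.
    move=> i; have := le_trans (mx_entry_le_norm _ _ _ (b - b') i 0) bb'.
    rewrite !mxE -mulrBl -mulrBr => bi.
    rewrite normrM normrM (gtr0_norm w0) normfV (@gtr0_norm _ (2 * Delta)) ?mulr_gt0//.
    rewrite ler_pdivrMr ?mulr_gt0//.
    have -> : w / 2 * (2 * Delta) = w * Delta by field.
    rewrite ler_pM2l// distrC.
    by have -> : forall u v t : R, u - v - (u - t) = t - v by move=> u v t; ring.
  by exists Y; split=> // ; apply: YK.
have := mw_loop_loss_le _ _ _ A (learning_rate A alpha) T _ _ lam _ lam0
  (expR_ge0 _) (fun x => gibbs_ge0 _ _ _) step T (uniform_vec) 0 S eps.
move=> /le_trans; apply; rewrite lerD2l -expRM_natl -expRD.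
rewrite -[leRHS](lnK delta0) ler_expR.
have -> : - (lam * eps) + T%:R * ((lam + 1) ^+ 2 * w ^+ 2 / 8) = eps - 16 * L.
  by rewrite wE /lam; field; rewrite !gt_eqF.
by rewrite /L in epsL L0 *; lra.
Qed.

(** * Entropy decrease under multiplicative weights, and success of the loop *)

Section MultiplicativeWeights.
Context {R : realType} {m d : nat}.
Implicit Types (A : 'M[R]_(m, d)) (b : 'cV[R]_m) (x z : 'cV[R]_d).

(** Relative entropy of [z] to [x] plus the entropy of [z], a constant under updates of [x]; it
    avoids logarithms of the entries of [z]. *)
Definition cross_entropy z x : R := - \sum_j z j 0 * ln (x j 0).

Lemma cross_entropy_ge0 z x : is_distribution z -> is_distribution x ->
  0 <= cross_entropy z x.
Proof.
move=> [z0 _] [x0 x1]; rewrite oppr_ge0 sumr_le0// => j _.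
rewrite mulr_ge0_le0// ln_le0// -x1 (bigD1 j)//= lerDl.
by apply: sumr_ge0.
Qed.

Lemma mw_updateE A (eta : R) x p j : mw_update A eta x p j 0 =
  (expR (- eta * (A p j / width A)) * x j 0) /
  \sum_k expR (- eta * (A p k / width A)) * x k 0.
Proof.
rewrite /mw_update !mxE mulrC; congr (_ / _).
by apply: eq_bigr => k _; rewrite !mxE.
Qed.

Lemma mw_normalizer_gt0 A (eta : R) x p : is_distribution x ->
  0 < \sum_j expR (- eta * (A p j / width A)) * x j 0.
Proof.
move=> [x0 x1]; rewrite lt0r sumr_ge0 ?andbT => [|j _]; last first.
  by rewrite mulr_ge0 ?expR_ge0.
apply/negP => /eqP Z0; have := oner_neq0 R; rewrite -x1 big1 ?eqxx// => j _.
have /eqP := Z0; rewrite psumr_eq0 => [/allP/(_ j)|k _].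
  rewrite mem_index_enum => /(_ isT).
  by rewrite mulf_eq0 gt_eqF ?expR_gt0//= => /eqP.
by rewrite mulr_ge0 ?expR_ge0.
Qed.

Lemma mw_update_distribution A (eta : R) x p : is_distribution x ->
  is_distribution (mw_update A eta x p).
Proof.
move=> xd; have Z0 := mw_normalizer_gt0 A eta x p xd; split=> [j|].
  by rewrite mw_updateE divr_ge0 ?(ltW Z0)// mulr_ge0 ?expR_ge0//; case: xd.
under eq_bigr do rewrite mw_updateE.
by rewrite -mulr_suml divff// gt_eqF.
Qed.

Lemma mw_update_gt0 A (eta : R) x p : is_distribution x ->
  (forall j, 0 < x j 0) -> forall j, 0 < mw_update A eta x p j 0.
Proof.
move=> xd x0 j; rewrite mw_updateE divr_gt0 ?mw_normalizer_gt0//.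
by rewrite mulr_gt0 ?expR_gt0.
Qed.

(** The update adds [eta] times the loss of [z] plus the log of the normalizer, which Hoeffding's
    lemma with range [2 * eta] bounds by [eta ^+ 2 / 2] minus [eta] times the loss of [x]. *)
Lemma mw_update_cross_entropy A (eta : R) z x p :
  0 <= eta -> is_distribution z -> is_distribution x -> (forall j, 0 < x j 0) ->
  cross_entropy z (mw_update A eta x p) <=
  cross_entropy z x + eta * (((A *m z) p 0 - (A *m x) p 0) / width A) + eta ^+ 2 / 2.
Proof.
move=> eta0 [z0 z1] xd x0; have Z0 := mw_normalizer_gt0 A eta x p xd.
set l := fun j => A p j / width A; set Z := \sum_j _ in Z0.
have AE y : (A *m y) p 0 / width A = \sum_j y j 0 * l j.
  by rewrite mxE mulr_suml; apply: eq_bigr => j _; rewrite mulrAC mulrC.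
have l1 j : `|l j| <= 1.
  rewrite /l /width normrM normfV normr_id.
  have [->|w0] := eqVneq `|A| 0; first by rewrite invr0 mulr0.
  by rewrite ler_pdivrMr ?mul1r ?mx_entry_le_norm// lt0r w0 normr_ge0.
have lnZ : ln Z <= - eta * \sum_j x j 0 * l j + eta ^+ 2 / 2.
  rewrite -ler_expR lnK ?posrE//.
  have lb j : - eta <= - eta * l j <= - eta + 2 * eta.
    have := l1 j; rewrite ler_norml => /andP[lj1 lj2].
    by rewrite -[X in X <= _ <= _]mulr1; apply/andP; split; nra.
  have := hoeffding_expR _ _ (fun j => x j 0) _ _ _ (proj1 xd) (proj2 xd) lb.
  under eq_bigr do rewrite mulrC.
  move=> /le_trans; apply; rewrite ler_expR.
  under eq_bigr do rewrite mulrCA.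
  by rewrite -mulr_sumr; lra.
have -> : cross_entropy z (mw_update A eta x p) =
    cross_entropy z x + eta * (\sum_j z j 0 * l j) + ln Z.
  have -> : ln Z = \sum_j z j 0 * ln Z by rewrite -mulr_suml z1 mul1r.
  rewrite /cross_entropy mulr_sumr -!sumrN -!big_split/=.
  apply: eq_bigr => j _; rewrite mw_updateE ln_div ?posrE ?mulr_gt0 ?expR_gt0//.
  by rewrite lnM ?posrE ?expR_gt0// expRK /l; ring.
rewrite mulrBl !AE; lra.
Qed.

End MultiplicativeWeights.

(* [c] bounds the violation accumulated so far plus the regret budget still to be
   spent; a round increases it by exactly the gap of the drawn constraint. *)
Lemma mw_loop_success (R : realType) (m d : nat) (A : 'M[R]_(m, d)) (b : 'cV[R]_m)
    (eta : R) (T : nat) (o : 'cV[R]_d -> 'I_m -> R) (alpha theta K : R) (z : 'cV[R]_d) :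
  0 < width A -> 0 < eta -> (0 < T)%N -> 0 <= theta -> 0 <= K ->
  is_distribution z -> (forall i, (A *m z) i 0 <= b i 0) ->
  (forall x i, 0 <= o x i) -> (forall x, \sum_i o x i = 1) ->
  (forall x, exists V, (forall i, (A *m x) i 0 - b i 0 <= V) /\
    \sum_i o x i * expR (theta * (V - ((A *m x) i 0 - b i 0))) <= K) ->
  forall n x s c, is_distribution x -> (forall j, 0 < x j 0) ->
  (forall i, (A *m s) i 0 - (T%:R - n%:R) * b i 0
     + width A / eta * cross_entropy z x + n%:R * (width A * eta / 2) <= c) ->
  1 - expR (theta * (c - T%:R * alpha)) * K ^+ n <=
    mw_loop A eta T o n x s [set x | forall i, (A *m x) i 0 <= b i 0 + alpha].
Proof.
move=> w0 eta0 T0 theta0 K0 zd zb o0 o1 oK; have T0' : 0 < T%:R :> R by rewrite ltr0n.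
elim=> [|n IH] x s c xd x0 inv /=.
  (* If [c] exceeds [T * alpha] the claimed probability is at most 0; otherwise the invariant, with
     its nonnegative entropy term dropped, is the required accuracy. *)
  rewrite expr0 mulr1; have [cT|cT] := leP c (T%:R * alpha); last first.
    rewrite indicE; apply: (@le_trans _ _ 0); last by case: (_ \in _).
    by rewrite subr_le0 -[leLHS]expR0 ler_expR mulr_ge0// subr_ge0 ltW.
  rewrite indicE mem_set /=; first by rewrite gerBl expR_ge0.
  move=> i; rewrite -scalemxAr mxE mulrC ler_pdivrMr//.
  have := inv i; rewrite mul0r addr0 subr0.
  have : 0 <= width A / eta * cross_entropy z x.
    by rewrite mulr_ge0 ?divr_ge0 ?(ltW w0) ?(ltW eta0) ?cross_entropy_ge0.
  by lra.
have [V [Vmax oV]] := oK x.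
apply: (@le_trans _ _ (\sum_p o x p *
    (1 - expR (theta * (c + (V - ((A *m x) p 0 - b p 0)) - T%:R * alpha)) * K ^+ n))).
  under eq_bigr => p _.
    have -> : theta * (c + (V - ((A *m x) p 0 - b p 0)) - T%:R * alpha) =
      theta * (c - T%:R * alpha) + theta * (V - ((A *m x) p 0 - b p 0)) by ring.
    rewrite expRD mulrBr mulr1 mulrAC mulrCA; over.
  rewrite sumrB o1 lerD2l lerN2 -mulr_sumr exprS [leRHS]mulrA [leRHS]mulrAC.
  by rewrite ler_wpM2l// mulr_ge0 ?expR_ge0 ?exprn_ge0.
apply: ler_sum => p _; apply: ler_wpM2l => //; apply: IH.
- exact: mw_update_distribution.
- exact: mw_update_gt0.
move=> i; rewrite mulmxDr mxE.
(* Scaled by [width A / eta], the entropy drop pays for the excess of [p], as [z] is feasible;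
   constraint [i] gains at most [V], so only the gap is charged to [c]. *)
have := mw_update_cross_entropy A eta z x p (ltW eta0) zd xd x0.
set CE' := cross_entropy z (mw_update _ _ _ _); set CE := cross_entropy z x.
rewrite -(ler_pM2l (divr_gt0 w0 eta0)).
have -> : width A / eta * (CE + eta * (((A *m z) p 0 - (A *m x) p 0) / width A)
      + eta ^+ 2 / 2) =
    width A / eta * CE + ((A *m z) p 0 - (A *m x) p 0) + width A * eta / 2.
  by field; rewrite !gt_eqF.
have := inv i; rewrite -/CE -[in n.+1%:R]addn1 natrD.
by have := zb p; have := Vmax i; lra.
Qed.

(** * The gap of the drawn constraint, and the number of rounds *)

Lemma gibbs_gap_moment (R : realType) (I : finType) (i0 : I) (f : I -> R) (theta : R) :
  exists V, (forall i, f i <= V) /\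
    \sum_i gibbs (fun k => theta * f k) i * expR (theta * (V - f i)) <= #|I|%:R.
Proof.
case: (@arg_maxP _ _ _ i0 predT f isT) => i1 _ fi1.
exists (f i1); split=> [i|]; first exact: fi1.
apply: (@le_trans _ _ (\sum_(i : I) 1)); last by rewrite sumr_const.
have Z0 := sum_expR_gt0 _ _ (fun k => theta * f k) i0.
(* Each term is [expR (theta * V)] over the normalizer, which contains that same weight at the
   maximizer [i1]. *)
apply: ler_sum => i _; rewrite /gibbs mulrAC -expRD ler_pdivrMr// mul1r.
rewrite mulrBr addrC subrK (bigD1 i1)//= lerDl.
by apply: sumr_ge0 => k _; exact: expR_ge0.
Qed.

Lemma uniform_vec_distribution (R : realType) (d : nat) : (0 < d)%N ->
  is_distribution (uniform_vec : 'cV[R]_d).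
Proof.
move=> d0; split=> [j|]; first by rewrite mxE invr_ge0.
under eq_bigr do rewrite mxE.
by rewrite sumr_const card_ord -[_^-1 *+ d]mulr_natr mulVf// pnatr_eq0 -lt0n.
Qed.

Lemma cross_entropy_uniform (R : realType) (d : nat) (z : 'cV[R]_d) : (0 < d)%N ->
  is_distribution z -> cross_entropy z uniform_vec = ln d%:R.
Proof.
move=> d0 [_ z1]; rewrite /cross_entropy; under eq_bigr do rewrite mxE.
by rewrite -mulr_suml z1 mul1r lnV ?opprK// posrE ltr0n.
Qed.

Lemma rounds_ge (R : realType) (m d : nat) (A : 'M[R]_(m, d)) (alpha : R) :
  9 * width A ^+ 2 * ln d%:R / alpha ^+ 2 <= (rounds A alpha)%:R.
Proof.
rewrite /rounds; set Y := (_ / _).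
apply: (le_trans (ceil_ge Y)); apply: (@le_trans _ _ (`|Num.ceil Y|%N%:~R)).
  by rewrite ler_int lez_abs.
by rewrite -pmulrn ler_nat leq_maxr.
Qed.

Lemma rounds_le (R : realType) (m d : nat) (A : 'M[R]_(m, d)) (alpha : R) :
  1 < 9 * width A ^+ 2 * ln d%:R / alpha ^+ 2 ->
  (rounds A alpha)%:R <= 2 * (9 * width A ^+ 2 * ln d%:R / alpha ^+ 2).
Proof.
rewrite /rounds; set Y := (_ / _) => Y1.
have cY : (1 <= Num.ceil Y)%R by rewrite -gtz0_ge1 ceil_gt0; lra.
have -> : maxn 1 `|Num.ceil Y|%N = `|Num.ceil Y|%N.
  by apply/maxn_idPr; rewrite -lez_nat gez0_abs// (le_trans _ cY).
rewrite pmulrn gez0_abs; last by apply: le_trans cY.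
have := ceilB1_lt Y; rewrite intrB; lra.
Qed.

Lemma rounds1 (R : realType) (m d : nat) (A : 'M[R]_(m, d)) (alpha : R) :
  9 * width A ^+ 2 * ln d%:R / alpha ^+ 2 <= 1 ->
  0 <= 9 * width A ^+ 2 * ln d%:R / alpha ^+ 2 -> rounds A alpha = 1%N.
Proof.
rewrite /rounds; set Y := (_ / _) => Y1 Y0; apply/maxn_idPl.
rewrite -lez_nat gez0_abs; first by rewrite ceil_le_int.
by rewrite ceil_ge0; lra.
Qed.

(** [4 / 9] is the value for which [9 * width A ^+ 2 * ln d%:R <= alpha ^+ 2] yields
    [2 * width A <= alpha]; it follows from [expR (- (4 / 9)) >= 5 / 9]. *)
Lemma ln2_ge (R : realType) : 4 / 9 <= ln 2 :> R.
Proof.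
rewrite -ler_expR lnK ?posrE//.
have := expR_ge1Dx (- (4 / 9) : R); rewrite expRN.
have e0 := expR_gt0 (4 / 9 : R); rewrite -(ler_pM2r e0) mulVf ?gt_eqF//; lra.
Qed.

Lemma ln_nat_ge (R : realType) (n : nat) : (1 < n)%N -> 4 / 9 <= ln n%:R :> R.
Proof.
move=> n1; apply: (le_trans (ln2_ge R)).
by rewrite ler_ln ?posrE ?ltr0n ?ler_nat// (ltn_trans _ n1).
Qed.

Lemma distribution_gap_le (R : realType) (m d : nat) (A : 'M[R]_(m, d))
    (x z : 'cV[R]_d) i : is_distribution x -> is_distribution z ->
  (A *m x) i 0 <= (A *m z) i 0 + 2 * width A.
Proof.
have bnd (y : 'cV[R]_d) : is_distribution y -> `|(A *m y) i 0| <= width A.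
  move=> [y0 y1]; rewrite mxE; apply: (le_trans (ler_norm_sum _ _ _)).
  rewrite -[leRHS]mulr1 -y1 mulr_sumr ler_sum// => j _.
  by rewrite normrM (ger0_norm (y0 j)) ler_wpM2r// mx_entry_le_norm.
move=> /bnd; rewrite ler_norml => /andP[_ h1] /bnd; rewrite ler_norml => /andP[h2 _].
lra.
Qed.

Lemma distribution1 (R : realType) (x : 'cV[R]_1) : is_distribution x -> x = const_mx 1.
Proof.
by move=> [_ x1]; apply/colP => j; rewrite mxE -x1 big_ord1 ord1.
Qed.

(** * Accuracy of the whole algorithm *)

Lemma primal_mw_one_round (R : realType) (m d : nat) (A : 'M[R]_(m, d)) (b : 'cV[R]_m)
    (alpha eps delta Delta : R) (S : set 'cV[R]_d) :
  (0 < m)%N -> rounds A alpha = 1%N -> S uniform_vec ->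
  primal_mw alpha eps delta Delta b A S = 1.
Proof.
move=> m0 T1 Su; rewrite /primal_mw T1 /= invr1 scale1r add0r.
under eq_bigr do rewrite indicE mem_set// mulr1.
exact: exp_mechanism_sum1.
Qed.

(** Half of [alpha] pays for the regret, half for the gaps. [theta] and [K] stay abstract because a
    single constraint calls for other values than the general case. *)
Lemma primal_mw_success (R : realType) (m d : nat) (A : 'M[R]_(m, d)) (b : 'cV[R]_m)
    (alpha beta eps delta Delta theta K : R) (z : 'cV[R]_d) :
  (0 < m)%N -> 0 < alpha -> 0 < beta < 1 ->
  1 < 9 * width A ^+ 2 * ln d%:R / alpha ^+ 2 ->
  is_distribution z -> (forall i, (A *m z) i 0 <= b i 0) ->
  0 <= theta -> 1 <= K -> ln K + ln (1 / beta) <= theta * alpha / 2 ->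
  (forall x, exists V, (forall i, (A *m x) i 0 - b i 0 <= V) /\
    \sum_i exp_mechanism A b (oracle_privacy A alpha eps delta) Delta x i
      * expR (theta * (V - ((A *m x) i 0 - b i 0))) <= K) ->
  1 - beta <= primal_mw alpha eps delta Delta b A
       [set x : 'cV[R]_d | forall i, (A *m x) i 0 <= b i 0 + alpha].
Proof.
move=> m0 alpha0 /andP[beta0 beta1] Y1 zd zb theta0 K1 bound gap.
have d1 : (1 < d)%N.
  rewrite ltnNge; apply: contraPN Y1 => d1; apply/negP; rewrite -leNgt.
  suff -> : ln d%:R = 0 :> R by rewrite mulr0 mul0r.
  by case: d d1 {A z zd zb gap} => [|[]]// _; rewrite ?ln1 ?ln0.
have ld0 : 0 < ln d%:R :> R by have := ln_nat_ge R _ d1; lra.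
have w0 : 0 < width A.
  rewrite lt0r normr_ge0 andbT; apply: contraPN Y1 => /eqP ->.
  by rewrite expr0n /= mulr0 !mul0r ltr10.
have T0 := rounds_gt0 _ _ _ A alpha; have TY := rounds_ge _ _ _ A alpha.
rewrite /primal_mw; set o := exp_mechanism _ _ _ _; set eta := learning_rate _ _.
set T := rounds A alpha in T0 TY *.
have etaE : eta ^+ 2 = ln d%:R / T%:R by rewrite sqr_sqrtr// divr_ge0 ?ltW.
have eta0 : 0 < eta by rewrite sqrtr_gt0 divr_gt0.
(* The initial entropy costs [T * width A * eta] and the regret budget half as much; the 9 in the
   number of rounds makes the total at most [T * alpha / 2]. *)
have regret : 3 * (width A * eta) <= alpha.
  rewrite -(ler_pXn2r (ltn0Sn 1)) ?nnegrE ?mulr_ge0 ?(ltW w0) ?(ltW eta0) ?(ltW alpha0)//.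
  rewrite !exprMn etaE !mulrA ler_pdivrMr//.
  by move: TY; rewrite ler_pdivrMr ?exprn_gt0//; lra.
have d0 : (0 < d)%N by apply: ltn_trans d1.
apply: (le_trans _ (mw_loop_success R m d A b eta T o alpha theta K z w0 eta0 _
  theta0 _ zd zb _ _ gap T uniform_vec 0 (T%:R * alpha / 2) _ _ _)) => //.
- rewrite lerD2l lerN2.
  have K0 : 0 < K by apply: lt_le_trans K1.
  (* The failure bound is [expR (T * (ln K - theta * alpha / 2))], hence at most
     [beta ^+ T <= beta]. *)
  rewrite -(lnK K0) -expRM_natl -expRD -[leRHS](lnK beta0) ler_expR.
  have lb : 0 <= ln (1 / beta) by rewrite ln_ge0// ler_pdivlMr// mul1r ltW.
  have T1 : 1 <= T%:R :> R by rewrite ler1n -(ltr0n R).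
  have := ler_wpM2l (ltW T0) bound.
  have := ler_wpM2r lb T1; rewrite div1r lnV ?posrE//; lra.
- by rewrite -(ltr0n R).
- by apply: le_trans K1.
- by move=> x i; apply: gibbs_ge0.
- by move=> x; apply: exp_mechanism_sum1.
- exact: uniform_vec_distribution.
- by move=> j; rewrite mxE invr_gt0 ltr0n.
- move=> i; rewrite mulmx0 mxE subrr mul0r subr0 add0r cross_entropy_uniform//.
  have -> : ln d%:R = eta ^+ 2 * T%:R :> R by rewrite etaE divfK// gt_eqF.
  have -> : width A / eta * (eta ^+ 2 * T%:R) = T%:R * (width A * eta).
    by field; rewrite gt_eqF.
  by have := ler_wpM2l (ltW T0) regret; lra.
Qed.

Lemma accuracy_rate_sqr (R : realType) (m d : nat) (A : 'M[R]_(m, d))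
    (beta eps delta Delta : R) : (0 < m)%N -> (0 < d)%N ->
  0 < beta < 1 -> 0 < eps -> 0 < delta < 1 -> 0 < Delta ->
  accuracy_rate A beta eps delta Delta ^+ 2 =
  width A * Delta / eps * Num.sqrt (ln d%:R) * Num.sqrt (ln (1 / delta))
    * ln (1 / beta) * ln m%:R.
Proof.
move=> m0 d0 /andP[beta0 beta1] eps0 /andP[delta0 delta1] Delta0.
have sqr2 (u : R) : 0 <= u -> (u `^ (1 / 2)) ^+ 2 = u.
  by move=> u0; rewrite div1r powR12_sqrt// sqr_sqrtr.
have sqr4 (u : R) : 0 <= u -> (u `^ (1 / 4)) ^+ 2 = Num.sqrt u.
  move=> u0; rewrite -powR12_sqrt// -powR_mulrn ?powR_ge0// -powRrM.
  by congr (_ `^ _); field.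
have ln1V u : 0 < u < 1 -> 0 <= ln (1 / u) :> R.
  by move=> /andP[u0 u1]; rewrite ln_ge0// ler_pdivlMr// mul1r ltW.
rewrite /accuracy_rate !exprMn !exprVn !sqr2 ?sqr4 ?ln1V ?ln_ge0 ?ler1n ?beta0 ?delta0 ?normr_ge0 ?ltW//.
Qed.

(** Here [ln m = 0] makes the accuracy rate vanish, but the gap is always 0, so [K = 1] works with
    any [theta]; the chosen one gives equality in the tail condition. *)
Lemma primal_mw_success_one_constraint (R : realType) (d : nat) (A : 'M[R]_(1, d))
    (b : 'cV[R]_1) (alpha beta eps delta Delta : R) (z : 'cV[R]_d) :
  0 < alpha -> 0 < beta < 1 ->
  1 < 9 * width A ^+ 2 * ln d%:R / alpha ^+ 2 ->
  is_distribution z -> (forall i, (A *m z) i 0 <= b i 0) ->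
  1 - beta <= primal_mw alpha eps delta Delta b A
       [set x : 'cV[R]_d | forall i, (A *m x) i 0 <= b i 0 + alpha].
Proof.
move=> alpha0 beta01 Y1 zd zb; have /andP[beta0 beta1] := beta01.
have lb : 0 <= ln (1 / beta) by rewrite ln_ge0// ler_pdivlMr// mul1r ltW.
apply: (primal_mw_success R 1 d A b alpha beta eps delta Delta
  (2 * ln (1 / beta) / alpha) 1 z) => //.
- by rewrite divr_ge0 ?mulr_ge0// ltW.
- by rewrite ln1 le_eqVlt; apply/orP; left; apply/eqP; field; rewrite gt_eqF.
move=> x; exists ((A *m x) 0 0 - b 0 0); split=> [i|]; first by rewrite ord1.
have := exp_mechanism_sum1 A b (oracle_privacy A alpha eps delta) Delta x (ltn0Sn 0).
by rewrite !big_ord1 subrr mulr0 expR0 mulr1 => ->.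
Qed.

(** The per-round privacy parameter is itself proportional to [alpha], up to rounding, so the tail
    condition is quadratic in [alpha] and is compared with the squared rate. *)
Lemma primal_mw_success_of_rate (R : realType) (m d : nat) (A : 'M[R]_(m, d))
    (b : 'cV[R]_m) (alpha beta beta0 eps delta Delta : R) (z : 'cV[R]_d) :
  (1 < m)%N -> (0 < d)%N -> 0 < alpha -> 0 < beta <= beta0 -> beta0 < 1 ->
  0 < eps -> 0 < delta < 1 -> 0 < Delta ->
  1 < 9 * width A ^+ 2 * ln d%:R / alpha ^+ 2 ->
  is_distribution z -> (forall i, (A *m z) i 0 <= b i 0) ->
  (48 * ((ln (1 / beta0))^-1 + 9 / 4) + 1) * accuracy_rate A beta eps delta Delta
    <= alpha ->
  1 - beta <= primal_mw alpha eps delta Delta b A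
       [set x : 'cV[R]_d | forall i, (A *m x) i 0 <= b i 0 + alpha].
Proof.
move=> m1 d0 alpha0 /andP[beta_gt0 beta_le] beta01 eps0 delta01 Delta0 Y1 zd zb rate.
have m0 : (0 < m)%N := ltn_trans (ltn0Sn 0) m1.
have beta1 : 0 < beta < 1 by rewrite beta_gt0 (le_lt_trans beta_le).
have beta0_gt0 : 0 < beta0 := lt_le_trans beta_gt0 beta_le.
have rate2 := accuracy_rate_sqr R m d A beta eps delta Delta m0 d0 beta1 eps0 delta01 Delta0.
have rate0 : 0 <= accuracy_rate A beta eps delta Delta.
  by rewrite /accuracy_rate !mulr_ge0 ?invr_ge0 ?powR_ge0.
have L0 : 0 < ln (1 / delta).
  by case/andP: delta01 => h1 h2; rewrite ln_gt0// ltr_pdivlMr// mul1r.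
have l0 : 0 < ln (1 / beta0) by rewrite ln_gt0// ltr_pdivlMr// mul1r.
have lb : ln (1 / beta0) <= ln (1 / beta).
  by rewrite ler_ln ?posrE ?divr_gt0// ler_pM2l// lef_pV2.
have lm := ln_nat_ge R _ m1.
have T0 := rounds_gt0 _ _ _ A alpha; have TY := rounds_le _ _ _ A alpha Y1.
have ld0 : 0 <= ln d%:R :> R by rewrite ln_ge0 ?ler1n.
apply: (primal_mw_success R m d A b alpha beta eps delta Delta
  (oracle_privacy A alpha eps delta / (2 * Delta)) m%:R z) => //.
- by rewrite divr_ge0 ?(mulr_ge0 _ (ltW Delta0))// divr_ge0 ?sqrtr_ge0 ?(ltW eps0).
- by rewrite ler1n.
- rewrite /oracle_privacy; set T := rounds A alpha in T0 TY *.
  move: lb lm L0 l0 ld0 rate rate0 rate2 TY.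
  set r := accuracy_rate _ _ _ _ _; set L := ln (1 / delta); set lb := ln (1 / beta).
  set l := ln (1 / beta0); set lm := ln m%:R; set ld := ln d%:R; set C := _ + 1.
  move=> llb mlm L0 l0 ld0 rate rate0 rate2 TY.
  set s := Num.sqrt (8 * T%:R * L).
  have s0 : 0 < s by rewrite sqrtr_gt0 !mulr_gt0.
  set q := width A * Num.sqrt ld * Num.sqrt L.
  have q0 : 0 <= q by rewrite !mulr_ge0 ?sqrtr_ge0 ?normr_ge0.
  (* [12 ^+ 2 = 8 * 2 * 9], the 2 coming from rounding up the number of rounds. *)
  have sq : s * alpha <= 12 * q.
    rewrite -(ler_pXn2r (ltn0Sn 1)) ?nnegrE ?(mulr_ge0 _ q0) ?(mulr_ge0 (ltW s0) (ltW alpha0))//.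
    rewrite !exprMn !sqr_sqrtr ?(ltW L0)//; last by rewrite !mulr_ge0// ltW.
    move: TY; rewrite mulrA ler_pdivlMr ?exprn_gt0// => TY.
    by have := ler_wpM2l (ltW L0) TY; lra.
  (* The rate has a product of logarithms where the tail has a sum; the product dominates because
     [beta <= beta0] and [1 < m] bound both factors below. *)
  have lmb : lm + lb <= (l^-1 + 9 / 4) * (lb * lm).
    have h1 : l * lm <= lb * lm by rewrite ler_wpM2r//; lra.
    have : lm <= l^-1 * (lb * lm) by rewrite mulrC ler_pdivlMr// mulrC.
    have : 4 / 9 * lb <= lm * lb by rewrite ler_wpM2r//; lra.
    lra.
  have C1 : 1 <= C by rewrite /C; have : 0 < l^-1 by [rewrite invr_gt0]; lra.
  (* [48 = 4 * 12] collects the factor 12 of [sq] and the 4 of the denominator; the [+ 1] in [C]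
     ensures [C <= C ^+ 2]. *)
  have CC : 48 * (l^-1 + 9 / 4) <= C ^+ 2.
    have : C * 1 <= C * C by rewrite ler_wpM2l//; lra.
    by rewrite /C; lra.
  have r2 : C ^+ 2 * r ^+ 2 <= alpha ^+ 2.
    have C0 : 0 <= C by lra.
    by rewrite -exprMn ler_pXn2r ?nnegrE ?(mulr_ge0 C0 rate0) ?(ltW alpha0).
  have lb0 : 0 <= lb * lm by rewrite mulr_ge0//; lra.
  have -> : eps / s / (2 * Delta) * alpha / 2 = eps * alpha ^+ 2 / (4 * Delta * (s * alpha)).
    by field; rewrite !gt_eqF.
  rewrite ler_pdivlMr ?mulr_gt0//.
  apply: (@le_trans _ _ ((l^-1 + 9 / 4) * (lb * lm) * (4 * Delta * (12 * q)))).
    apply: ler_pM => //; [lra| |].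
      by rewrite !mulr_ge0 ?(ltW s0) ?(ltW alpha0) ?(ltW Delta0).
    by rewrite ler_pM2l// mulr_gt0.
  have h : 48 * (l^-1 + 9 / 4) * (lb * lm * (Delta * q)) <= C ^+ 2 * (lb * lm * (Delta * q)).
    by rewrite ler_wpM2r// (mulr_ge0 lb0 (mulr_ge0 (ltW Delta0) q0)).
  have e1 : eps * r ^+ 2 = lb * lm * (Delta * q).
    by rewrite rate2 /q /lb /lm; field; rewrite gt_eqF.
  have := ler_wpM2l (ltW eps0) r2.
  by rewrite mulrCA e1; lra.
move=> x; have [V [V1 V2]] := gibbs_gap_moment R _ (Ordinal m0)
  (fun i => (A *m x) i 0 - b i 0) (oracle_privacy A alpha eps delta / (2 * Delta)).
exists V; split=> //; rewrite card_ord in V2; apply: le_trans V2.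
rewrite le_eqVlt; apply/orP; left; apply/eqP; apply: eq_bigr => i _; congr (_ * _).
have wE k : oracle_privacy A alpha eps delta * ((A *m x) k 0 - b k 0) / (2 * Delta)
  = oracle_privacy A alpha eps delta / (2 * Delta) * ((A *m x) k 0 - b k 0).
  by rewrite mulrAC.
by rewrite /exp_mechanism /gibbs wE; congr (_ / _); apply: eq_bigr => k _; rewrite wE.
Qed.

Lemma uniform_feasible (R : realType) (m d : nat) (A : 'M[R]_(m, d)) (alpha : R)
    (z : 'cV[R]_d) i : (0 < d)%N -> 0 < alpha ->
  9 * width A ^+ 2 * ln d%:R / alpha ^+ 2 <= 1 -> is_distribution z ->
  (A *m uniform_vec) i 0 <= (A *m z) i 0 + alpha.
Proof.
move=> d0 alpha0 Y1 zd; have ud := uniform_vec_distribution R _ d0.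
have [d1|d1] := leqP d 1.
  have dE : d = 1%N by apply/eqP; rewrite eqn_leq d1.
  subst d; rewrite (distribution1 _ _ zd) (distribution1 _ _ ud) lerDl ltW//.
apply: (le_trans (distribution_gap_le R _ _ A _ _ i ud zd)); rewrite lerD2l.
rewrite -(ler_pXn2r (ltn0Sn 1)) ?nnegrE ?mulr_ge0 ?normr_ge0 ?(ltW alpha0)//.
move: Y1; rewrite ler_pdivrMr ?exprn_gt0// mul1r; apply: le_trans.
rewrite exprMn; have := ler_wpM2l (sqr_ge0 (width A)) (ln_nat_ge R _ d1); lra.
Qed.

Theorem theorem22 (R : realType) (beta0 : R) (hbeta0 : 0 < beta0 < 1) :
  exists (C : R) (k : nat), 0 < C /\
  forall (m d : nat) (A : 'M[R]_(m, d)) (b : 'cV[R]_m)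
         (alpha beta eps delta Delta : R),
    (0 < m)%N ->
    0 < alpha < 1 -> 0 < beta <= beta0 ->
    0 < eps -> 0 < delta < 1 -> 0 < Delta ->
    (exists x : 'cV[R]_d,
       is_distribution x /\ forall i, (A *m x) i 0 <= b i 0) ->
    (eps <= 8 * ln (1 / delta) ->
     low_sensitivity_scalar_private eps delta Delta
       (@primal_mw R m d alpha eps delta Delta))
    /\
    (soft_bound C k (accuracy_rate A beta eps delta Delta) <= alpha ->
     1 - beta <= primal_mw alpha eps delta Delta b A
       [set x : 'cV[R]_d | forall i, (A *m x) i 0 <= b i 0 + alpha]).
Proof.
have /andP[beta0_gt0 beta0_lt1] := hbeta0.
have l0 : 0 < ln (1 / beta0) by rewrite ln_gt0// ltr_pdivlMr// mul1r.
exists (48 * ((ln (1 / beta0))^-1 + 9 / 4) + 1), 0%N; split.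
  by have : 0 < (ln (1 / beta0))^-1 by [rewrite invr_gt0]; lra.
move=> m d A b alpha beta eps delta Delta m0 /andP[alpha0 _] betab eps0 delta01 Delta0.
move=> [z [zd zb]]; split=> [epsL|]; first exact: primal_mw_private.
rewrite /soft_bound expr0 mulr1 => rate.
have d0 : (0 < d)%N.
  rewrite lt0n; apply/eqP => dE; subst d; case: zd => _.
  by rewrite big_ord0 => /eqP; rewrite eq_sym oner_eq0.
have beta01 : 0 < beta < 1.
  by case/andP: betab => -> /le_lt_trans ->.
have [Y1|Y1] := leP (9 * width A ^+ 2 * ln d%:R / alpha ^+ 2) 1.
  rewrite primal_mw_one_round//.
  - by rewrite gerBl; case/andP: betab => /ltW.
  - apply: rounds1 => //.
    by rewrite divr_ge0 ?sqr_ge0// mulr_ge0 ?ln_ge0 ?ler1n// mulr_ge0 ?sqr_ge0.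
  by move=> i; apply: (le_trans (uniform_feasible R _ _ A _ z i d0 alpha0 Y1 zd)); rewrite lerD2r.
have [m1|m1] := leqP m 1.
  have mE : m = 1%N by apply/eqP; rewrite eqn_leq m1.
  by subst m; apply: primal_mw_success_one_constraint zd zb.
exact: (primal_mw_success_of_rate R m d A b alpha beta beta0 eps delta Delta z).
Qed.
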